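(* Let $j\in\mathbb{Z}_{\ge 0}$ and $k\in\mathbb{Z}_{>0}$. Then $$\sum_{n=1}^{\infty}\frac{4^n}{n^{k+1}\binom{2n}{n}}\,t_n^{\star}(\{2\}_j)=\frac{2^{k+3}}{(k-1)!}\int_0^1\frac{\ln^{k-1}\!\left(\frac{1+t^2}{2t}\right)\operatorname{Ti}_{2j+1}(t)}{1+t^2}\,dt.$$
   Context: For $n\in\mathbb{Z}_{>0}$ and $j\in\mathbb{Z}_{\ge 0}$, $$t_n^{\star}(\{2\}_j):=\sum_{n\ge n_1\ge\cdots\ge n_j\ge 1}\prod_{i=1}^j\frac{1}{(2n_i-1)^2},$$ where the $n_i$ are integers, with the convention $t_n^{\star}(\{2\}_0)=t_n^\star(\emptyset)=1$. For $m\in\mathbb{Z}_{>0}$ the inverse tangent integral is $\operatorname{Ti}_m(x):=\sum_{n=1}^{\infty}\frac{(-1)^{n-1}x^{2n-1}}{(2n-1)^m}$ for $|x|\le 1$ (so $\operatorname{Ti}_1=\arctan$). $\ln^{k-1}(\cdot)$ denotes the $(k-1)$-th power of the natural logarithm. *)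

(* Defs.v *)
From Stdlib Require Import Reals Lia Arith.
From Coquelicot Require Import Coquelicot.
From Stdlib Require Import List Sorted FinFun.
Import ListNotations.
Open Scope R_scope.

Fixpoint index_seqs (n j : nat) : list (list nat) :=
  match j with
  | O => [[]]
  | S j' => flat_map (fun m => map (cons m) (index_seqs m j')) (seq 1 n)
  end.

(* [index_seqs n j] lists, each exactly once, the integer sequences
   (n_1, ..., n_j) with n >= n_1 >= ... >= n_j >= 1. *)
Lemma index_seqsP (n j : nat) (s : list nat) :
  In s (index_seqs n j) <->
  length s = j /\ Sorted ge (n :: s) /\ Forall (fun m => (1 <= m)%nat) s.
Proof.
revert n s; induction j as [|j IH]; intros n s; simpl.
- split.
  + intros [<-|[]]; repeat constructor.
  + intros [H _]; left; destruct s; [reflexivity|discriminate].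
- rewrite in_flat_map; split.
  + intros [m [Hm Hs]]; apply in_seq in Hm; apply in_map_iff in Hs.
    destruct Hs as [s' [<- Hs']]; apply IH in Hs' as [H1 [H2 H3]].
    split; [simpl; congruence|]; split.
    * constructor; [exact H2|constructor; lia].
    * constructor; [lia|exact H3].
  + intros [H1 [H2 H3]]; destruct s as [|m s]; [discriminate|].
    inversion H2 as [|? ? H4 H5]; inversion H5; inversion H3; subst.
    exists m; split; [apply in_seq; lia|].
    apply in_map, IH; repeat split; auto.
Qed.

Lemma index_seqs_NoDup (n j : nat) : NoDup (index_seqs n j).
Proof.
revert n; induction j as [|j IH]; intros n; simpl.
- repeat constructor; intros [].
- generalize (seq_NoDup n 1); induction (seq 1 n) as [|m l IHl]; simpl; intros Hl.
  + constructor.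
  + inversion Hl as [|? ? Hm Hl']; subst.
    apply NoDup_app; [|now apply IHl|].
    * apply Injective_map_NoDup; [|apply IH].
      intros a b E; now injection E.
    * intros s Hs Hs'; apply in_map_iff in Hs as [s1 [<- _]].
      apply in_flat_map in Hs' as [m' [Hm' Hs']].
      apply in_map_iff in Hs' as [s2 [E _]]; injection E; intros; subst; auto.
Qed.

Definition Rsum (l : list R) : R := fold_right Rplus 0 l.
Definition Rprod (l : list R) : R := fold_right Rmult 1 l.

Definition t_star (n j : nat) : R :=
  Rsum (map (fun s => Rprod (map (fun m => 1 / (2 * INR m - 1) ^ 2) s))
            (index_seqs n j)).

(* Only meaningful for 0 < m and |x| <= 1, where the series converges
   (conditionally at x = 1, -1 when m = 1). *)
Definition Ti (m : nat) (x : R) : R :=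
  Series (fun i => let n := S i in
    (-1) ^ (n - 1) * x ^ (2 * n - 1) / (2 * INR n - 1) ^ m).

(* The singularity at t = 0 is removable: Ti (2 * j + 1) t = O(t) beats the
   logarithm. Ti vanishes at 0, so the totalised [ln] and [/] give the value 0
   there, which is also the limit. *)
Definition integrand (j k : nat) (t : R) : R :=
  ln ((1 + t ^ 2) / (2 * t)) ^ (k - 1) * Ti (2 * j + 1) t / (1 + t ^ 2).

(* [Binomial.C] is Stdlib's binomial coefficient; Coquelicot's [C] is the
   complex numbers. *)
Definition summand (j k n : nat) : R :=
  4 ^ n / (INR n ^ (k + 1) * Binomial.C (2 * n) n) * t_star n j.

(* Main.v *)
Require Import Defs.
From Stdlib Require Import Reals Factorial.
From Coquelicot Require Import Coquelicot.
From Stdlib Require Import Lra Lia List.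
Open Scope R_scope.

(** Let theta = t d/dt, xi = 2t/(1+t^2), eta = (1-t^2)/(1+t^2), so that
    theta xi = xi eta, theta eta = - xi^2 (for t = exp (-s) these are 1/cosh s
    and tanh s).  The functions b_n = 4^n/(n C(2n,n)) eta xi^(2n-1) / 4 satisfy
    theta^2 b_n = (2n-1)^2 b_n - (2n+1)^2 b_(n+1), so summation by parts gives
    theta^2 (sum_(n <= N) t*_n({2}_(j+1)) b_n)
      = sum_(n <= N) t*_n({2}_j) b_n - (2N+1)^2 t*_N({2}_(j+1)) b_(N+1).
    As theta^2 Ti_(2j+3) = Ti_(2j+1), and as |theta f| <= eps t with f(0) = 0
    implies |f| <= eps t, induction on j yields
    Ti_(2j+1) = sum_n t*_n({2}_j) b_n uniformly on [0, r] for every r < 1.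
    Integrating against ln^(k-1)(1/xi) / (1+t^2), where
    b_n / (1+t^2) is a multiple of xi^(2n-1) xi', produces the factor
    (k-1)!/(2n)^k; near t = 1 the partial sums lie between 0 and Ti_(2j+1),
    so the tail of the integral is uniformly small. *)

(** * The Euler operator [t d/dt] *)

Definition is_euler (f : R -> R) (t l : R) : Prop :=
  exists d, is_derive f t d /\ l = t * d.

Lemma is_euler_ext (f g : R -> R) (t l : R) :
  (forall s, f s = g s) -> is_euler f t l -> is_euler g t l.
Proof.
intros fg [d [Hd ->]]; exists d; split; [|reflexivity].
now apply is_derive_ext with f.
Qed.

Lemma is_euler_plus (f g : R -> R) (t a b : R) :
  is_euler f t a -> is_euler g t b -> is_euler (fun s => f s + g s) t (a + b).
Proof.
intros [d [Hd ->]] [e [He ->]]; exists (d + e); split; [|ring].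
exact (is_derive_plus f g t d e Hd He).
Qed.

Lemma is_euler_minus (f g : R -> R) (t a b : R) :
  is_euler f t a -> is_euler g t b -> is_euler (fun s => f s - g s) t (a - b).
Proof.
intros [d [Hd ->]] [e [He ->]]; exists (d - e); split; [|ring].
exact (is_derive_minus f g t d e Hd He).
Qed.

Lemma is_euler_scal (c : R) (f : R -> R) (t a : R) :
  is_euler f t a -> is_euler (fun s => c * f s) t (c * a).
Proof.
intros [d [Hd ->]]; exists (c * d); split; [|ring].
exact (is_derive_scal f t c d Hd).
Qed.

Lemma is_euler_mult (f g : R -> R) (t a b : R) :
  is_euler f t a -> is_euler g t b ->
  is_euler (fun s => f s * g s) t (a * g t + f t * b).
Proof.
intros [d [Hd ->]] [e [He ->]]; exists (d * g t + f t * e); split; [|ring].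
exact (is_derive_mult f g t d e Hd He Rmult_comm).
Qed.

(** Stating the hypothesis through the logarithmic derivative [a] keeps [f t ^ n] in the result and
    avoids dividing by [f t], which may vanish at 0. *)
Lemma is_euler_pow (f : R -> R) (n : nat) (t a : R) :
  is_euler f t (f t * a) ->
  is_euler (fun s => f s ^ n) t (INR n * a * f t ^ n).
Proof.
intros Hf; induction n as [|n IH].
- exists 0; split; [exact (is_derive_const 1 t)|simpl; ring].
- replace (INR (S n) * a * f t ^ S n)
    with (f t * a * f t ^ n + f t * (INR n * a * f t ^ n))
    by (rewrite S_INR; simpl; ring).
  exact (is_euler_mult f (fun s => f s ^ n) t _ _ Hf IH).
Qed.

Lemma is_euler_sum_n (f g : nat -> R -> R) (t : R) (N : nat) :
  (forall i, is_euler (f i) t (g i t)) ->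
  is_euler (fun s => sum_n (fun i => f i s) N) t (sum_n (fun i => g i t) N).
Proof.
intros Hfg; induction N as [|N IH].
- rewrite sum_O; apply is_euler_ext with (f 0%nat); [|apply Hfg].
  intros s; now rewrite sum_O.
- rewrite sum_Sn.
  apply is_euler_ext with (fun s => sum_n (fun i => f i s) N + f (S N) s).
  + intros s; now rewrite sum_Sn.
  + now apply is_euler_plus.
Qed.

(** Mean value theorem: [f t = t * f'(c)] with [0 < c < t], and
    [c * Rabs (f'(c)) = Rabs (g c) <= eps * c]. The constant [eps] is not enlarged, so the lemma can
    be iterated. *)
Lemma euler_bound (f g : R -> R) (r eps : R) :
  (forall t, 0 <= t <= r -> is_euler f t (g t)) -> f 0 = 0 ->
  (forall t, 0 <= t <= r -> Rabs (g t) <= eps * t) ->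
  forall t, 0 <= t <= r -> Rabs (f t) <= eps * t.
Proof.
intros Hf f0 Hg t Ht.
destruct (Req_dec t 0) as [->|t0].
{ rewrite f0, Rabs_R0; lra. }
destruct (MVT_cor2 f (Derive f) 0 t) as [c [Hc Hct]]; [lra| |].
{ intros c Hc; apply is_derive_Reals, Derive_correct.
  destruct (Hf c) as [d [Hd _]]; [lra|]; now exists d. }
rewrite f0, !Rminus_0_r in Hc; rewrite Hc, Rabs_mult, (Rabs_pos_eq t) by lra.
apply Rmult_le_compat_r; [lra|].
destruct (Hf c) as [d [Hd Ed]]; [lra|]; rewrite (is_derive_unique _ _ _ Hd).
specialize (Hg c ltac:(lra)); rewrite Ed, Rabs_mult, (Rabs_pos_eq c) in Hg by lra.
apply Rmult_le_reg_l with c; lra.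
Qed.

(** * The basis functions *)

Definition xi (t : R) : R := 2 * t / (1 + t ^ 2).
Definition eta (t : R) : R := (1 - t ^ 2) / (1 + t ^ 2).

Lemma one_plus_sq_pos (t : R) : 0 < 1 + t ^ 2.
Proof. nra. Qed.

Lemma eta_sq (t : R) : eta t ^ 2 = 1 - xi t ^ 2.
Proof. unfold eta, xi; field; pose proof (one_plus_sq_pos t); lra. Qed.

Lemma is_euler_xi (t : R) : is_euler xi t (xi t * eta t).
Proof.
pose proof (one_plus_sq_pos t).
exists (2 * (1 - t ^ 2) / (1 + t ^ 2) ^ 2); split.
- unfold xi; auto_derive; [lra|field; lra].
- unfold xi, eta; field; lra.
Qed.

Lemma is_euler_eta (t : R) : is_euler eta t (- xi t ^ 2).
Proof.
pose proof (one_plus_sq_pos t).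
exists (- 4 * t / (1 + t ^ 2) ^ 2); split.
- unfold eta; auto_derive; [lra|field; lra].
- unfold xi; field; lra.
Qed.

(* Indices are shifted: [coef i] and [basis i] belong to [n = i + 1]. *)
Definition coef (i : nat) : R :=
  4 ^ S i / (INR (S i) * Binomial.C (2 * S i) (S i)).

Lemma coef_0 : coef 0 = 2.
Proof. unfold coef, Binomial.C; simpl; field. Qed.

(** The ratio of consecutive terms is [2n / (2n + 1)] with [n = i + 1]; it makes the Euler
    derivatives of the basis functions telescope. *)
Lemma coef_S (i : nat) : (2 * INR i + 3) * coef (S i) = (2 * INR i + 2) * coef i.
Proof.
unfold coef, Binomial.C.
replace (2 * S (S i) - S (S i))%nat with (S (S i)) by lia.
replace (2 * S i - S i)%nat with (S i) by lia.
replace (2 * S (S i))%nat with (S (S (2 * S i))) by lia.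
assert (E2 : INR (2 * S i) = 2 * INR i + 2)
  by (rewrite mult_INR, (S_INR i); simpl (INR 2); ring).
(* With [2 * S i] abstracted to [m], [fact_simpl] peels off just the two top factors and leaves
   [fact m] intact. *)
revert E2; generalize (2 * S i)%nat as m; intros m E2.
rewrite (fact_simpl (S m)), (fact_simpl m), (fact_simpl (S i)), !mult_INR.
rewrite !(S_INR (S _)), (S_INR m), (S_INR i), E2.
pose proof (pos_INR i).
pose proof (INR_fact_neq_0 m); pose proof (INR_fact_neq_0 (S i)).
rewrite <- (tech_pow_Rmult 4 (S i)); field; repeat split; try lra; auto.
Qed.

Lemma coef_bounds (i : nat) : 0 < coef i <= 2.
Proof.
induction i as [|i IH]; [rewrite coef_0; lra|].
pose proof (coef_S i); pose proof (pos_INR i); nra.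
Qed.

Definition basis (i : nat) (t : R) : R := coef i / 4 * (eta t * xi t ^ (2 * i + 1)).
(* A prime marks the image under [t d/dt], not the derivative. *)
Definition basis' (i : nat) (t : R) : R :=
  coef i / 4 * ((2 * INR i + 1) * xi t ^ (2 * i + 1)
    - (2 * INR i + 2) * xi t ^ (2 * i + 3)).

Lemma INR_odd1 (i : nat) : INR (2 * i + 1) = 2 * INR i + 1.
Proof. rewrite plus_INR, mult_INR; simpl; ring. Qed.

Lemma INR_odd3 (i : nat) : INR (2 * i + 3) = 2 * INR i + 3.
Proof. rewrite plus_INR, mult_INR; simpl; ring. Qed.

Lemma is_euler_basis (i : nat) (t : R) : is_euler (basis i) t (basis' i t).
Proof.
unfold basis, basis'; apply is_euler_scal.
replace (_ - _) with
  (- xi t ^ 2 * xi t ^ (2 * i + 1)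
   + eta t * (INR (2 * i + 1) * eta t * xi t ^ (2 * i + 1))).
- apply is_euler_mult; [apply is_euler_eta|].
  apply is_euler_pow, is_euler_xi.
- replace (2 * i + 3)%nat with (2 + (2 * i + 1))%nat by lia.
  rewrite (pow_add _ 2 (2 * i + 1)), INR_odd1.
  replace (eta t * ((2 * INR i + 1) * eta t * xi t ^ (2 * i + 1)))
    with (eta t ^ 2 * (2 * INR i + 1) * xi t ^ (2 * i + 1)) by ring.
  rewrite eta_sq; ring.
Qed.

(** Each power of [xi] reproduces itself times its exponent and [eta]. The higher one,
    [xi ^ (2 * i + 3)], is that of [basis (S i)], and [coef_S] converts the coefficient. *)
Lemma is_euler_basis' (i : nat) (t : R) :
  is_euler (basis' i) t ((2 * INR i + 1) ^ 2 * basis i t - (2 * INR i + 3) ^ 2 * basis (S i) t).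
Proof.
unfold basis'.
replace (_ - _) with
  (coef i / 4 * ((2 * INR i + 1) * (INR (2 * i + 1) * eta t * xi t ^ (2 * i + 1))
    - (2 * INR i + 2) * (INR (2 * i + 3) * eta t * xi t ^ (2 * i + 3)))).
- apply is_euler_scal, is_euler_minus; apply is_euler_scal, is_euler_pow, is_euler_xi.
- unfold basis.
  replace (2 * S i + 1)%nat with (2 * i + 3)%nat by lia.
  rewrite INR_odd1, INR_odd3.
  replace ((2 * INR i + 3) ^ 2 * (coef (S i) / 4 * (eta t * xi t ^ (2 * i + 3))))
    with ((2 * INR i + 3) * ((2 * INR i + 3) * coef (S i)) / 4
      * (eta t * xi t ^ (2 * i + 3))) by field.
  rewrite coef_S; field.
Qed.

Lemma xi_bounds (t : R) : 0 <= t <= 1 -> 0 <= xi t <= 1 /\ t <= xi t <= 2 * t.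
Proof.
intros Ht; pose proof (one_plus_sq_pos t).
assert (Hx : xi t * (1 + t ^ 2) = 2 * t) by (unfold xi; field; lra).
assert (0 <= xi t) by (unfold xi; apply Rdiv_le_0_compat; lra).
repeat split; try nra; apply Rmult_le_reg_r with (1 + t ^ 2); nra.
Qed.

Lemma eta_bounds (t : R) : 0 <= t <= 1 -> 0 <= eta t <= 1.
Proof.
intros Ht; pose proof (one_plus_sq_pos t).
assert (HH : eta t * (1 + t ^ 2) = 1 - t ^ 2) by (unfold eta; field; lra).
split; apply Rmult_le_reg_r with (1 + t ^ 2); nra.
Qed.

(** After clearing denominators the difference is [2 * (t - s) * (1 - s * t)]. *)
Lemma xi_le (s t : R) : 0 <= s <= t -> t <= 1 -> xi s <= xi t.
Proof.
intros Hs Ht.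
pose proof (one_plus_sq_pos t); pose proof (one_plus_sq_pos s).
apply Rmult_le_reg_r with ((1 + s ^ 2) * (1 + t ^ 2)); [nra|].
replace (xi s * _) with (2 * s * (1 + t ^ 2)) by (unfold xi; field; lra).
replace (xi t * _) with (2 * t * (1 + s ^ 2)) by (unfold xi; field; lra).
assert (0 <= (t - s) * (1 - s * t)) by (apply Rmult_le_pos; nra). nra.
Qed.

Lemma xi_lt_1 (t : R) : t < 1 -> xi t < 1.
Proof.
intros Ht; pose proof (one_plus_sq_pos t).
apply Rmult_lt_reg_r with (1 + t ^ 2); [lra|].
replace (xi t * _) with (2 * t) by (unfold xi; field; lra). nra.
Qed.

Lemma basis_nonneg (i : nat) (t : R) : 0 <= t <= 1 -> 0 <= basis i t.
Proof.
intros Ht; unfold basis; pose proof (coef_bounds i).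
pose proof (xi_bounds t Ht); pose proof (eta_bounds t Ht).
apply Rmult_le_pos; [lra|].
apply Rmult_le_pos; [lra|apply pow_le; lra].
Qed.

(** One factor [xi t <= 2 * t] is split off to give a bound linear in [t], as [euler_bound]
    requires; its 2 is absorbed by [coef i / 4 <= 1 / 2]. The rest is geometric in [i] when
    [r < 1]. *)
Lemma basis_le (i : nat) (r t : R) :
  0 <= t <= r -> r <= 1 -> basis i t <= xi r ^ (2 * i) * t.
Proof.
intros Ht Hr; unfold basis; pose proof (coef_bounds i).
pose proof (xi_bounds t ltac:(lra)); pose proof (eta_bounds t ltac:(lra)).
rewrite pow_add, pow_1.
assert (xi t ^ (2 * i) <= xi r ^ (2 * i)).
{ apply pow_incr; split; [lra|now apply xi_le]. }
assert (0 <= xi t ^ (2 * i)) by (apply pow_le; lra).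
assert (0 <= xi t ^ (2 * i) * xi t) by nra.
assert (xi t ^ (2 * i) * xi t <= xi r ^ (2 * i) * (2 * t))
  by (apply Rmult_le_compat; lra).
assert (eta t * (xi t ^ (2 * i) * xi t) <= 1 * (xi t ^ (2 * i) * xi t))
  by (apply Rmult_le_compat_r; lra).
assert (0 <= eta t * (xi t ^ (2 * i) * xi t)) by (apply Rmult_le_pos; lra).
nra.
Qed.

(** * Nested sums *)

Lemma Rsum_app (l l' : list R) : Rsum (l ++ l') = Rsum l + Rsum l'.
Proof. induction l as [|a l IH]; simpl; [|rewrite IH]; ring. Qed.

Lemma Rsum_scal {T} (c : R) (f : T -> R) (l : list T) :
  Rsum (map (fun x => c * f x) l) = c * Rsum (map f l).
Proof. induction l as [|a l IH]; simpl; [|rewrite IH]; ring. Qed.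

Lemma t_star_0 (n : nat) : t_star n 0 = 1.
Proof. unfold t_star; simpl; ring. Qed.

Lemma t_star_0_S (j : nat) : t_star 0 (S j) = 0.
Proof. reflexivity. Qed.

(** The sequences split by their largest index: either it is at most [n], or it equals [S n], and
    then the tail of length [j] may again start at [S n] because the inequalities are weak. *)
Lemma t_star_S (n j : nat) :
  t_star (S n) (S j) = t_star n (S j) + t_star (S n) j / (2 * INR n + 1) ^ 2.
Proof.
unfold t_star at 1 2; cbn [index_seqs].
rewrite seq_S, flat_map_app, map_app, Rsum_app; f_equal.
cbn [flat_map Nat.add]; rewrite app_nil_r, map_map; cbn [map Rprod fold_right].
etransitivity; [apply Rsum_scal|].
change (Rsum _) with (t_star (S n) j).
rewrite S_INR.
replace (2 * (INR n + 1) - 1) with (2 * INR n + 1) by ring.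
unfold Rdiv; ring.
Qed.

(** A crude polynomial bound, enough against the geometric decay of [basis]. *)
Lemma t_star_bounds (n j : nat) : 0 <= t_star n j <= INR (S n) ^ j.
Proof.
revert n; induction j as [|j IH]; intros n; [rewrite t_star_0; simpl; lra|].
(* Sharper form suited to induction on [n]: each of the [n] values of the largest index contributes
   at most [INR (S n) ^ j]. *)
enough (0 <= t_star n (S j) <= INR n * INR (S n) ^ j).
{ split; [lra|]; rewrite S_INR in *; simpl.
  assert (0 <= (INR n + 1) ^ j) by (apply pow_le; pose proof (pos_INR n); lra).
  lra. }
induction n as [|n IHn]; [rewrite t_star_0_S; simpl; lra|].
rewrite t_star_S.
pose proof (pos_INR n); specialize (IH (S n)).
assert (INR (S n) ^ j <= INR (S (S n)) ^ j)
  by (apply pow_incr; rewrite !S_INR; lra).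
assert (0 <= t_star (S n) j / (2 * INR n + 1) ^ 2)
  by (apply Rdiv_le_0_compat; nra).
assert (t_star (S n) j / (2 * INR n + 1) ^ 2 <= INR (S (S n)) ^ j).
{ apply Rle_div_l; nra. }
assert (INR n * INR (S n) ^ j <= INR n * INR (S (S n)) ^ j) by nra.
rewrite (S_INR n); split; lra.
Qed.

(** Restated with equality and addition in [R], so that rewriting leaves terms accessible to [ring]
    and [lra]. *)
Lemma sum_n_R_O (f : nat -> R) : sum_n f 0 = f 0%nat :> R.
Proof. exact (sum_O f). Qed.

Lemma sum_n_R_S (f : nat -> R) (N : nat) :
  sum_n f (S N) = sum_n f N + f (S N) :> R.
Proof. exact (sum_Sn f N). Qed.

Definition Spart (j N : nat) (t : R) : R := sum_n (fun i => t_star (S i) j * basis i t) N.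
Definition Spart' (j N : nat) (t : R) : R := sum_n (fun i => t_star (S i) j * basis' i t) N.

Lemma is_euler_Spart (j N : nat) (t : R) : is_euler (Spart j N) t (Spart' j N t).
Proof.
apply is_euler_sum_n with (f := fun i t => t_star (S i) j * basis i t)
  (g := fun i t => t_star (S i) j * basis' i t).
intros i; apply is_euler_scal, is_euler_basis.
Qed.

(** Summation by parts: by [t_star_S] the increment of [t_star] carries [1 / (2 * INR i + 1) ^ 2],
    which cancels the factor of [basis i] and lowers [j]. For [j = 0] the weights are constant and
    the sum telescopes to its two ends. *)
Lemma is_euler_Spart' (j N : nat) (t : R) :
  is_euler (Spart' j N) t
    (match j with O => basis 0 t | S j' => Spart j' N t end
     - (2 * INR N + 3) ^ 2 * t_star (S N) j * basis (S N) t).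
Proof.
set (F i t := (2 * INR i + 1) ^ 2 * basis i t - (2 * INR i + 3) ^ 2 * basis (S i) t).
assert (G : sum_n (fun i => t_star (S i) j * F i t) N
  = match j with O => basis 0 t | S j' => Spart j' N t end
    - (2 * INR N + 3) ^ 2 * t_star (S N) j * basis (S N) t :> R).
- destruct j as [|j].
  + induction N as [|N IH].
    * rewrite sum_n_R_O; unfold F; rewrite !t_star_0; simpl INR; ring.
    * rewrite sum_n_R_S, IH; unfold F; rewrite !t_star_0, S_INR; ring.
  + unfold Spart; induction N as [|N IH].
    * rewrite !sum_n_R_O; unfold F; rewrite t_star_S, t_star_0_S.
      simpl INR; field.
    * rewrite !sum_n_R_S, IH, (t_star_S (S N)); unfold F.
      rewrite S_INR; field. pose proof (pos_INR N); lra.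
- rewrite <- G.
  apply is_euler_sum_n with (f := fun i t => t_star (S i) j * basis' i t)
    (g := fun i t => t_star (S i) j * F i t).
  intros i; apply is_euler_scal, is_euler_basis'.
Qed.

(** * Inverse tangent integrals *)

Definition Ti_coef (m i : nat) : R := (-1) ^ i / (2 * INR i + 1) ^ m.

(** Factoring out [t] leaves a power series in [t ^ 2], to which the differentiation theory of
    [PSeries] applies. *)
Lemma Ti_PSeries (m : nat) (t : R) : Ti m t = t * PSeries (Ti_coef m) (t ^ 2).
Proof.
unfold Ti, PSeries; rewrite <- Series_scal_l; apply Series_ext; intros i.
unfold Ti_coef; cbn zeta.
replace (S i - 1)%nat with i by lia.
replace (2 * S i - 1)%nat with (S (2 * i)) by lia.
rewrite S_INR, <- pow_mult.
replace (2 * (INR i + 1) - 1) with (2 * INR i + 1) by ring.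
unfold Rdiv; rewrite <- tech_pow_Rmult; ring.
Qed.

Lemma Ti_coef_le (m i : nat) : Rabs (Ti_coef m i) <= 1.
Proof.
unfold Ti_coef, Rdiv; pose proof (pos_INR i).
assert (H0 : 1 <= (2 * INR i + 1) ^ m) by (apply pow_R1_Rle; lra).
rewrite Rabs_mult, pow_1_abs, Rmult_1_l, Rabs_inv, Rabs_pos_eq.
- pose proof (Rinv_le_contravar 1 _ ltac:(lra) H0) as L; rewrite Rinv_1 in L; exact L.
- lra.
Qed.

Lemma Ti_coef_radius (m : nat) (y : R) :
  Rabs y < 1 -> Rbar_lt (Rabs y) (CV_radius (Ti_coef m)).
Proof.
intros Hy; apply Rbar_lt_le_trans with 1; [exact Hy|].
apply (CV_radius_bounded (Ti_coef m)); exists 1; intros n.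
rewrite pow1, Rmult_1_r; apply Ti_coef_le.
Qed.

(** Coefficientwise, [1 + 2 * i] cancels one factor of the denominator. With [y = t ^ 2] this is the
    relation between [Ti (S m)] and [Ti m] after division by [t]. *)
Lemma PSeries_Ti_coef_S (m : nat) (y : R) : Rabs y < 1 ->
  PSeries (Ti_coef (S m)) y + 2 * y * PSeries (PS_derive (Ti_coef (S m))) y
  = PSeries (Ti_coef m) y.
Proof.
intros Hy; pose proof (Ti_coef_radius (S m) y Hy) as Hr.
rewrite Rmult_assoc, <- PSeries_incr_1.
rewrite <- PSeries_scal, <- PSeries_plus.
- apply PSeries_ext; intros [|i].
  + unfold PS_plus, PS_scal, PS_incr_1, Ti_coef; simpl.
    unfold plus, scal; simpl; unfold mult; simpl.
    unfold zero; simpl. rewrite !Rmult_0_r, !Rplus_0_l, pow1; field.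
  + unfold PS_plus, PS_scal, PS_incr_1, PS_derive, Ti_coef.
    unfold plus, scal; cbn -[INR pow]; unfold mult; cbn -[INR pow].
    pose proof (pos_INR (S i)).
    rewrite <- (tech_pow_Rmult (2 * INR (S i) + 1)).
    field; split; [apply pow_nonzero|]; lra.
- now apply CV_radius_inside.
- apply ex_pseries_scal; [apply Rmult_comm|].
  now apply ex_pseries_incr_1, ex_pseries_derive.
Qed.

Lemma is_euler_Ti (m : nat) (t : R) : 0 <= t < 1 -> is_euler (Ti (S m)) t (Ti m t).
Proof.
intros Ht; assert (Hy : Rabs (t ^ 2) < 1) by (rewrite Rabs_pos_eq; nra).
exists (PSeries (Ti_coef (S m)) (t ^ 2)
  + t * (2 * t * PSeries (PS_derive (Ti_coef (S m))) (t ^ 2))); split.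
- apply is_derive_ext with (fun s => s * PSeries (Ti_coef (S m)) (s ^ 2)).
  { intros s; now rewrite Ti_PSeries. }
  pose proof (is_derive_PSeries (Ti_coef (S m)) (t ^ 2) (Ti_coef_radius _ _ Hy)) as D.
  assert (D2 : is_derive (fun s : R => s ^ 2) t (2 * t))
    by (auto_derive; [trivial|ring]).
  pose proof (is_derive_mult (fun s => s) (fun s => PSeries (Ti_coef (S m)) (s ^ 2))
    t 1 _ (is_derive_id t) (is_derive_comp _ (fun s => s ^ 2) t _ _ D D2) Rmult_comm) as D3.
  match type of D3 with is_derive _ _ ?l => replace (_ + _) with l; [exact D3|] end.
  unfold plus, mult, scal; simpl; unfold mult; simpl; ring.
- rewrite Ti_PSeries, <- PSeries_Ti_coef_S by exact Hy; ring.
Qed.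

Lemma Ti_0_r (m : nat) : Ti m 0 = 0.
Proof. rewrite Ti_PSeries; ring. Qed.

(** Index 0 extends the family one step below the arctangent; the series is geometric with ratio
    [- t ^ 2]. *)
Lemma Ti_0 (t : R) : -1 < t < 1 -> Ti 0 t = t / (1 + t ^ 2).
Proof.
intros Ht; rewrite Ti_PSeries; unfold Rdiv; f_equal.
replace (1 + t ^ 2) with (1 - - t ^ 2) by ring.
apply is_series_unique.
apply is_series_ext with (fun n => (- t ^ 2) ^ n).
- intros n; unfold Ti_coef, Rdiv.
  rewrite pow_O, Rinv_1, Rmult_1_r, <- Rpow_mult_distr; f_equal; ring.
- apply is_series_geom; rewrite Rabs_Ropp, Rabs_pos_eq; nra.
Qed.

(** Induction on [m]: [euler_bound] with constant 1 carries the bound from [Ti m] to [Ti (S m)]. *)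
Lemma Ti_le (m : nat) (t : R) : 0 <= t < 1 -> Rabs (Ti m t) <= t.
Proof.
revert t; induction m as [|m IH]; intros t Ht.
- rewrite Ti_0 by lra; rewrite Rabs_pos_eq.
  + apply Rle_div_l; nra.
  + apply Rdiv_le_0_compat; nra.
- replace t with (1 * t) at 2 by ring.
  apply euler_bound with (Ti m) t; [|apply Ti_0_r| |lra].
  + intros s Hs; apply is_euler_Ti; lra.
  + intros s Hs; rewrite Rmult_1_l; apply IH; lra.
Qed.

(** The derivative at [c] is [Ti m c / c], of absolute value at most 1 by [Ti_le]. This yields a
    left limit at 1 without studying the series there. *)
Lemma Ti_lipschitz (m : nat) (s t : R) :
  0 < s < 1 -> 0 < t < 1 -> Rabs (Ti (S m) t - Ti (S m) s) <= Rabs (t - s).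
Proof.
intros Hs Ht.
assert (D : forall c, 0 < c < 1 -> exists d, is_derive (Ti (S m)) c d /\ Rabs d <= 1).
{ intros c Hc; destruct (is_euler_Ti m c) as [d [Hd Ed]]; [lra|].
  exists d; split; [exact Hd|].
  pose proof (Ti_le m c ltac:(lra)) as L.
  rewrite Ed, Rabs_mult, (Rabs_pos_eq c) in L by lra; nra. }
destruct (MVT_gen (Ti (S m)) s t (Derive (Ti (S m)))) as [c [Hc Ed]].
- intros c Hc; destruct (D c) as [d [Hd _]].
  { revert Hc; unfold Rmin, Rmax; destruct Rle_dec; lra. }
  apply Derive_correct; now exists d.
- intros c Hc; destruct (D c) as [d [Hd _]].
  { revert Hc; unfold Rmin, Rmax; destruct Rle_dec; lra. }
  apply continuity_pt_filterlim.
  apply (ex_derive_continuous (Ti (S m))); now exists d.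
- destruct (D c) as [d [Hd L]].
  { revert Hc; unfold Rmin, Rmax; destruct Rle_dec; lra. }
  rewrite Ed, (is_derive_unique _ _ _ Hd), Rabs_mult.
  pose proof (Rabs_pos (t - s)); nra.
Qed.

(** * Convergence of the partial sums *)

(** Only the term of degree [p] of the exponential series is kept. *)
Lemma pow_le_fact_exp (p : nat) (u : R) : 0 <= u -> u ^ p <= INR (fact p) * exp u.
Proof.
intros Hu; pose proof (exp_ge_taylor u p Hu) as T.
pose proof (INR_fact_lt_0 p).
assert (u ^ p / INR (fact p) <= exp u).
{ eapply Rle_trans; [|exact T].
  destruct p as [|p]; [simpl; lra|rewrite tech5].
  enough (0 <= sum_f_R0 (fun k => u ^ k / INR (fact k)) p) by lra.
  apply cond_pos_sum; intros n.
  apply Rdiv_le_0_compat; [now apply pow_le|apply INR_fact_lt_0]. }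
rewrite Rmult_comm; now apply Rle_div_l.
Qed.

(** With [c = - ln q] and [M = 2 * INR N + 3], apply [pow_le_fact_exp] to [c * M] with exponent
    [S p]: the one extra power leaves a factor [1 / M], hence decay. *)
Lemma is_lim_seq_pow_geom (p : nat) (q : R) : 0 < q < 1 ->
  is_lim_seq (fun N => (2 * INR N + 3) ^ p * q ^ (2 * N + 2)) 0.
Proof.
intros Hq; set (c := - ln q).
assert (Hc : 0 < c).
{ pose proof (ln_increasing q 1 ltac:(lra) ltac:(lra)) as L.
  rewrite ln_1 in L; unfold c; lra. }
(* The factor [q] in the denominator turns [q ^ (2 * N + 3) = exp (- (c * M))] into the required
   [q ^ (2 * N + 2)]. *)
set (K := INR (fact (S p)) / (c ^ S p * q)).
apply is_lim_seq_le_le with (fun _ => 0) (fun N => K * / INR (S N)).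
- intros N; pose proof (pos_INR N).
  assert (0 <= (2 * INR N + 3) ^ p) by (apply pow_le; lra).
  assert (0 < q ^ (2 * N + 2)) by (apply pow_lt; lra).
  split; [nra|].
  set (M := 2 * INR N + 3) in *.
  assert (EM : exp (c * M) = / (q ^ (2 * N + 2) * q)).
  { replace (q ^ (2 * N + 2) * q) with (exp (- (c * M))).
    - rewrite exp_Ropp, Rinv_inv; reflexivity.
    - replace (q ^ (2 * N + 2) * q) with (q ^ (2 * N + 3))
        by (rewrite !pow_add; simpl; ring).
      rewrite <- Rpower_pow by lra; unfold Rpower; f_equal.
      unfold c, M; rewrite INR_odd3; ring. }
  pose proof (pow_le_fact_exp (S p) (c * M) ltac:(unfold M; nra)) as B.
  rewrite EM, Rpow_mult_distr in B.
  assert (0 < c ^ S p) by (now apply pow_lt).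
  assert (0 < q ^ (2 * N + 2) * q) by nra.
  assert (B2 : c ^ S p * M ^ S p * (q ^ (2 * N + 2) * q) <= INR (fact (S p))).
  { replace (INR (fact (S p)))
      with (INR (fact (S p)) * / (q ^ (2 * N + 2) * q) * (q ^ (2 * N + 2) * q))
      by (field; lra).
    apply Rmult_le_compat_r; lra. }
  assert (B3 : M ^ p * q ^ (2 * N + 2) * M <= K).
  { unfold K; apply -> Rle_div_r; [|apply Rmult_lt_0_compat; lra].
    rewrite <- (tech_pow_Rmult M) in B2; lra. }
  apply -> Rle_div_r; [|apply lt_0_INR; lia].
  eapply Rle_trans; [|exact B3].
  apply Rmult_le_compat_l; [nra|]; rewrite S_INR; unfold M; lra.
- apply is_lim_seq_const.
- replace 0 with (K * 0) by ring.
  apply (is_lim_seq_scal_l _ K 0).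
  apply (is_lim_seq_incr_1 (fun n => / INR n)).
  apply (is_lim_seq_inv _ p_infty); [apply is_lim_seq_INR|discriminate].
Qed.

(** Start of the induction on [j]: applying [t d/dt] to [t / (1 + t ^ 2)] gives [eta t * xi t / 2],
    and [coef 0 = 2]. *)
Lemma is_euler_Ti_0 (t : R) : 0 <= t < 1 -> is_euler (Ti 0) t (basis 0 t).
Proof.
intros Ht; pose proof (one_plus_sq_pos t).
exists ((1 - t ^ 2) / (1 + t ^ 2) ^ 2); split.
- apply is_derive_ext_loc with (fun s => s / (1 + s ^ 2)).
  (* The closed form holds only on [(-1, 1)]; the ball of radius [1 - t] around [t >= 0] stays
     inside it. *)
  + exists (mkposreal (1 - t) ltac:(lra)); intros s Hs.
    apply Rabs_def2 in Hs; simpl in Hs; unfold minus, plus, opp in Hs; simpl in Hs.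
    rewrite Ti_0; [reflexivity|lra].
  + auto_derive; [lra|field; lra].
- unfold basis, eta, xi; rewrite coef_0; simpl; field; nra.
Qed.

Lemma Spart_0_r (j N : nat) : Spart j N 0 = 0 /\ Spart' j N 0 = 0.
Proof.
assert (X0 : xi 0 = 0) by (unfold xi; field).
unfold Spart, Spart'; induction N as [|N [IH1 IH2]].
- rewrite !sum_n_R_O; unfold basis, basis'; rewrite X0; simpl; split; ring.
- rewrite !sum_n_R_S, IH1, IH2; unfold basis, basis'; rewrite X0.
  rewrite !pow_i by lia; split; ring.
Qed.

Lemma remainder_le (j N : nat) (r t : R) : 0 <= t <= r -> r <= 1 ->
  0 <= (2 * INR N + 3) ^ 2 * t_star (S N) j * basis (S N) t
  <= (2 * INR N + 3) ^ (2 + j) * xi r ^ (2 * N + 2) * t.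
Proof.
intros Ht Hr; pose proof (basis_nonneg (S N) t ltac:(lra)).
pose proof (basis_le (S N) r t Ht Hr) as L; pose proof (t_star_bounds (S N) j) as B.
pose proof (pos_INR N).
replace (2 * S N)%nat with (2 * N + 2)%nat in L by lia.
assert (INR (S (S N)) ^ j <= (2 * INR N + 3) ^ j)
  by (apply pow_incr; rewrite !S_INR; lra).
assert (0 <= (2 * INR N + 3) ^ 2) by nra.
rewrite (pow_add _ 2 j); split.
- apply Rmult_le_pos; [apply Rmult_le_pos|]; lra.
- rewrite (Rmult_assoc (_ * _) _ t).
  apply Rmult_le_compat; [apply Rmult_le_pos; lra|lra| |exact L].
  apply Rmult_le_compat_l; lra.
Qed.

(** The error is kept linear in [t], so that each stage can feed [euler_bound] for the next. *)
Lemma Spart_error (j : nat) (r : R) : 0 < r < 1 ->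
  exists e : nat -> R, is_lim_seq e 0 /\
    forall N t, 0 <= t <= r -> Rabs (Ti (2 * j + 1) t - Spart j N t) <= e N * t.
Proof.
intros Hr.
(* This bounds the boundary term left by summation by parts, see [remainder_le]. *)
set (d j N := (2 * INR N + 3) ^ (2 + j) * xi r ^ (2 * N + 2)).
assert (Hd : forall j, is_lim_seq (d j) 0).
{ intros i; apply (is_lim_seq_pow_geom (2 + i)).
  pose proof (xi_bounds r ltac:(lra)); pose proof (xi_lt_1 r ltac:(lra)); lra. }
(* Two applications of [euler_bound] undo two Euler derivatives. Leaving [g] and [G] free covers
   both cases: for [j = 0] both are [basis 0], otherwise they are the function and the partial sum
   of the previous level. *)
assert (step : forall (j : nat) (e : nat -> R) (g : R -> R) (G : nat -> R -> R),
  (forall t, 0 <= t <= r -> is_euler (Ti (2 * j)) t (g t)) ->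
  (forall N t, is_euler (Spart' j N) t
    (G N t - (2 * INR N + 3) ^ 2 * t_star (S N) j * basis (S N) t)) ->
  (forall N t, 0 <= t <= r -> Rabs (g t - G N t) <= e N * t) ->
  forall N t, 0 <= t <= r -> Rabs (Ti (2 * j + 1) t - Spart j N t) <= (e N + d j N) * t).
{ intros i e g G Hg HG He N.
  destruct (Spart_0_r i N) as [S0 S0'].
  apply euler_bound with (fun t => Ti (2 * i) t - Spart' i N t).
  - intros t Ht; rewrite Nat.add_1_r.
    apply is_euler_minus; [apply is_euler_Ti; lra|apply is_euler_Spart].
  - rewrite Ti_0_r, S0; ring.
  - apply euler_bound with (fun t => g t
      - (G N t - (2 * INR N + 3) ^ 2 * t_star (S N) i * basis (S N) t)).
    + intros t Ht; apply is_euler_minus; auto.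
    + rewrite Ti_0_r, S0'; ring.
    + intros t Ht; specialize (He N t Ht).
      pose proof (remainder_le i N r t Ht ltac:(lra)) as B.
      fold (d i N) in B.
      replace (g t - _) with ((g t - G N t)
        + (2 * INR N + 3) ^ 2 * t_star (S N) i * basis (S N) t) by ring.
      eapply Rle_trans; [apply Rabs_triang|].
      rewrite (Rabs_pos_eq (_ * _)) by lra; lra. }
induction j as [|j [e [He IH]]].
- exists (fun N => 0 + d 0%nat N); split.
  { apply is_lim_seq_ext with (d 0%nat); [intros n; ring|apply Hd]. }
  apply (step 0%nat (fun _ => 0) (fun t => basis 0 t) (fun _ t => basis 0 t)).
  + intros t Ht; apply is_euler_Ti_0; lra.
  + intros N t; apply (is_euler_Spart' 0 N t).
  + intros N t Ht; replace (_ - _) with 0 by ring; rewrite Rabs_R0; lra.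
- exists (fun N => e N + d (S j) N); split.
  { rewrite <- (Rplus_0_r 0); now apply is_lim_seq_plus'. }
  apply (step (S j) e (fun t => Ti (2 * j + 1) t) (Spart j)).
  + intros t Ht; replace (2 * S j)%nat with (S (2 * j + 1)) by lia.
    apply is_euler_Ti; lra.
  + intros N t; apply (is_euler_Spart' (S j) N t).
  + exact IH.
Qed.

(** * The logarithmic kernel *)

(** For [t > 0] this is [- ln (xi t)], see [exp_u]. *)
Definition u (t : R) : R := ln ((1 + t ^ 2) / (2 * t)).

(** These are default values: [ln] is 0 off the positive reals, and a quotient by 0 is 0. They make
    the bounds below hold on the whole line, as two-sided continuity at 0 requires. *)
Lemma u_nonpos (t : R) : t <= 0 -> u t = 0.
Proof.
intros Ht; unfold u, ln; destruct Rlt_dec as [h|]; [exfalso|reflexivity].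
destruct (Req_dec t 0) as [->|t0].
- rewrite Rmult_0_r, Rdiv_0_r in h; lra.
- pose proof (one_plus_sq_pos t).
  assert (/ (2 * t) < 0) by (apply Rinv_lt_0_compat; lra).
  unfold Rdiv in h; nra.
Qed.

Lemma xi_pos (t : R) : 0 < t -> 0 < xi t <= 1.
Proof.
intros Ht; pose proof (one_plus_sq_pos t); unfold xi; split.
- apply Rdiv_lt_0_compat; lra.
- apply <- Rle_div_l; [pose proof (pow2_ge_0 (1 - t))|]; nra.
Qed.

Lemma xi_abs (t : R) : Rabs (xi t) <= 1.
Proof.
pose proof (one_plus_sq_pos t).
unfold xi; apply Rabs_le; split.
- apply -> Rle_div_r; [pose proof (pow2_ge_0 (1 + t))|]; nra.
- apply <- Rle_div_l; [pose proof (pow2_ge_0 (1 - t))|]; nra.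
Qed.

Lemma exp_u (t : R) : 0 < t -> exp (u t) = / xi t.
Proof.
intros Ht; pose proof (one_plus_sq_pos t).
unfold u, xi; rewrite exp_ln; [field; lra|apply Rdiv_lt_0_compat; lra].
Qed.

Lemma u_nonneg (t : R) : 0 <= u t.
Proof.
destruct (Rle_lt_dec t 0) as [Ht|Ht]; [rewrite u_nonpos; lra|].
unfold u; rewrite <- ln_1; apply ln_le; [lra|].
apply -> Rle_div_r; [pose proof (pow2_ge_0 (1 - t))|]; nra.
Qed.

(* With [s = exp (- u / 2)] one has [xi t = s ^ 2], and [(u / 2) ^ p <= p! / s]. *)
Lemma xi_u_pow_le (p : nat) (t : R) :
  Rabs (xi t * u t ^ p) <= 2 ^ p * INR (fact p) * sqrt (Rabs (xi t)).
Proof.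
pose proof (INR_fact_lt_0 p); pose proof (u_nonneg t) as Hu.
assert (0 < 2 ^ p) by (apply pow_lt; lra).
assert (0 <= u t ^ p) by (apply pow_le; lra).
destruct (Rle_lt_dec t 0) as [Ht|Ht].
(* Here [u t = 0], so the power is at most 1 (it is 1 for [p = 0]), and
   [Rabs (xi t) <= sqrt (Rabs (xi t))] suffices. *)
- pose proof (xi_abs t) as Ha; pose proof (Rabs_pos (xi t)).
  pose proof (sqrt_sqrt _ H2); pose proof (sqrt_pos (Rabs (xi t))).
  assert (sqrt (Rabs (xi t)) <= 1) by (rewrite <- sqrt_1; now apply sqrt_le_1_alt).
  assert (Rabs (xi t) <= sqrt (Rabs (xi t))) by nra.
  assert (1 <= 2 ^ p * INR (fact p)).
  { assert (1 <= 2 ^ p) by (apply pow_R1_Rle; lra).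
    assert (1 <= INR (fact p)) by (apply (le_INR 1), lt_O_fact). nra. }
  assert (u t ^ p <= 1).
  { rewrite u_nonpos by exact Ht; rewrite <- (pow1 p); apply pow_incr; lra. }
  rewrite Rabs_mult, (Rabs_pos_eq (u t ^ p)) by lra. nra.
- destruct (xi_pos t Ht) as [Hx _].
  set (s := exp (- (u t / 2))).
  assert (Hs : 0 < s) by apply exp_pos.
  assert (Hss : s * s = xi t).
  { unfold s; rewrite <- exp_plus.
    replace (_ + _) with (- u t) by field.
    rewrite exp_Ropp, exp_u, Rinv_inv; auto. }
  assert (B := pow_le_fact_exp p (u t / 2) ltac:(lra)).
  replace (exp (u t / 2)) with (/ s) in B
    by (unfold s; now rewrite exp_Ropp, Rinv_inv).
  rewrite !Rabs_pos_eq by nra.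
  rewrite <- Hss, sqrt_square by lra.
  unfold Rdiv in B; rewrite Rpow_mult_distr, pow_inv in B.
  assert (B2 : u t ^ p * s <= 2 ^ p * INR (fact p)).
  { replace (u t ^ p * s) with (u t ^ p * / 2 ^ p * (2 ^ p * s)) by (field; lra).
    replace (2 ^ p * INR (fact p))
      with (INR (fact p) * / s * (2 ^ p * s)) by (field; lra).
    apply Rmult_le_compat_r; nra. }
  nra.
Qed.

Lemma xi_u_pow_bound (p : nat) (t : R) :
  Rabs (xi t * u t ^ p) <= 2 ^ p * INR (fact p).
Proof.
eapply Rle_trans; [apply xi_u_pow_le|].
assert (sqrt (Rabs (xi t)) <= 1)
  by (rewrite <- sqrt_1; apply sqrt_le_1_alt, xi_abs).
pose proof (INR_fact_lt_0 p); assert (0 < 2 ^ p) by (apply pow_lt; lra).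
rewrite <- (Rmult_1_r (2 ^ p * INR (fact p))) at 2.
apply Rmult_le_compat_l; nra.
Qed.

Definition dxi (t : R) : R := 2 * (1 - t ^ 2) / (1 + t ^ 2) ^ 2.

Lemma is_derive_xi (t : R) : is_derive xi t (dxi t).
Proof.
pose proof (one_plus_sq_pos t).
unfold xi, dxi; auto_derive; [lra|field; lra].
Qed.

Lemma is_derive_u (t : R) : 0 < t -> is_derive u t (- dxi t / xi t).
Proof.
intros Ht; pose proof (one_plus_sq_pos t).
unfold u, xi, dxi; auto_derive.
- repeat split; [lra|]. apply Rmult_lt_0_compat; [lra|apply Rinv_0_lt_compat; lra].
- field; lra.
Qed.

Lemma continuous_squeeze_0 (f g : R -> R) (a : R) :
  (forall t, Rabs (f t) <= g t) -> g a = 0 -> continuous g a -> continuous f a.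
Proof.
intros fg ga Hg.
assert (fa : f a = 0).
{ specialize (fg a); rewrite ga in fg; apply Rabs_eq_0.
  pose proof (Rabs_pos (f a)); lra. }
apply filterlim_locally; intros eps.
pose proof (proj1 (filterlim_locally _ _) Hg eps) as L.
apply filter_imp with (2 := L); intros t Ht.
unfold ball in *; simpl in *; unfold AbsRing_ball, abs, minus, plus, opp in *; simpl in *.
rewrite fa; rewrite ga in Ht; rewrite Ropp_0, Rplus_0_r in *.
specialize (fg t); apply Rabs_def2 in Ht; lra.
Qed.

Lemma continuous_Rmult (f g : R -> R) (t : R) :
  continuous f t -> continuous g t -> continuous (fun s => f s * g s) t.
Proof. exact (continuous_mult f g t). Qed.

(** At 0 the product is squeezed by a multiple of [sqrt (Rabs (xi s))]: one factor [xi] absorbs the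
    logarithms and the others are at most 1 in absolute value. *)
Lemma continuous_xi_u (p q : nat) (t : R) :
  0 <= t -> continuous (fun s => xi s ^ S q * u s ^ p) t.
Proof.
intros Ht; destruct Ht as [Ht|<-].
- apply (ex_derive_continuous (V := R_NormedModule)).
  apply (ex_derive_mult (fun s => xi s ^ S q) (fun s => u s ^ p)).
  + apply (ex_derive_pow xi); eexists; apply is_derive_xi.
  + apply (ex_derive_pow u); eexists; now apply is_derive_u.
- apply continuous_squeeze_0
    with (fun s => 2 ^ p * INR (fact p) * sqrt (Rabs (xi s))).
  + intros s; eapply Rle_trans; [|apply xi_u_pow_le].
    simpl pow; replace (_ * _) with (xi s ^ q * (xi s * u s ^ p)) by ring.
    rewrite Rabs_mult, <- RPow_abs.
    assert (Rabs (xi s) ^ q <= 1)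
      by (rewrite <- (pow1 q); apply pow_incr; split; [apply Rabs_pos|apply xi_abs]).
    pose proof (Rabs_pos (xi s * u s ^ p)); nra.
  + unfold xi, Rdiv; rewrite Rmult_0_r, Rmult_0_l, Rabs_R0, sqrt_0; ring.
  + apply (continuous_Rmult (fun _ => _)); [apply continuous_const|].
    apply (continuous_comp (fun s => Rabs (xi s)) sqrt); [|apply continuous_sqrt].
    apply (continuous_comp xi Rabs); [|apply continuous_Rabs].
    apply (ex_derive_continuous (V := R_NormedModule)).
    eexists; apply is_derive_xi.
Qed.

Lemma continuous_dxi (t : R) : continuous dxi t.
Proof.
apply (ex_derive_continuous (V := R_NormedModule)).
pose proof (one_plus_sq_pos t).
unfold dxi; auto_derive; nra.
Qed.

(** The difference quotient at 0 is [c h] itself, so continuity of [c] is enough. This handles the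
    endpoint where the logarithm is singular. *)
Lemma is_derive_mul_id_0 (c : R -> R) :
  continuous c 0 -> is_derive (fun t => t * c t) 0 (c 0).
Proof.
intros Hc; apply is_derive_Reals; intros eps Heps.
destruct (proj1 (filterlim_locally _ _) Hc (mkposreal eps Heps)) as [d Hd].
exists d; intros h h0 Hh.
replace (((0 + h) * c (0 + h) - 0 * c 0) / h - c 0) with (c h - c 0)
  by (rewrite Rplus_0_l; field; exact h0).
apply (Hd h); unfold ball; simpl; unfold AbsRing_ball, abs, minus, plus, opp; simpl.
now rewrite Ropp_0, Rplus_0_r.
Qed.

Lemma is_derive_xi_u (p q : nat) (t : R) : 0 <= t ->
  is_derive (fun s => xi s ^ S (S q) * u s ^ S p) t
    (INR (S (S q)) * (xi t ^ S q * u t ^ S p * dxi t)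
     - INR (S p) * (xi t ^ S q * u t ^ p * dxi t)).
Proof.
intros [Ht|<-].
- pose proof (xi_pos t Ht).
  pose proof (is_derive_mult (fun s => xi s ^ S (S q)) (fun s => u s ^ S p) t _ _
    (is_derive_pow xi (S (S q)) t _ (is_derive_xi t))
    (is_derive_pow u (S p) t _ (is_derive_u t Ht)) Rmult_comm) as D.
  match type of D with is_derive _ _ ?l => replace (_ - _) with l; [exact D|] end.
  unfold plus, mult; cbn -[INR pow]; unfold mult; cbn -[INR pow].
  cbn [Nat.pred].
  rewrite <- (tech_pow_Rmult (xi t) (S q)), <- (tech_pow_Rmult (u t) p).
  field; lra.
- assert (xi0 : xi 0 = 0) by (unfold xi; field).
  (* One of the two guaranteed factors [xi s] supplies the [s]; the other keeps [c] continuous at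
     0. *)
  set (c s := 2 / (1 + s ^ 2) * (xi s ^ S q * u s ^ S p)).
  replace (_ - _) with (c 0) by (unfold c; rewrite xi0, (pow_i (S q)) by lia; ring).
  apply is_derive_ext with (fun s => s * c s).
  { intros s; match goal with |- ?x = ?y => change (@eq R x y) end.
    unfold c; rewrite <- (tech_pow_Rmult (xi s) (S q)); unfold xi at 2.
    field; pose proof (one_plus_sq_pos s); lra. }
  apply is_derive_mul_id_0, (continuous_Rmult (fun s => 2 / (1 + s ^ 2))).
  + apply (ex_derive_continuous (V := R_NormedModule)); auto_derive; nra.
  + apply continuous_xi_u; lra.
Qed.

(** In the variable [x = xi t] this is the integral of [x ^ (q + 1) * (- ln x) ^ p] over [[0, 1]].
    It is computed by parts, by induction on [p]; the boundary terms vanish since [xi 0 = 0] and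
    [u 1 = 0]. *)
Lemma is_RInt_xi_u (p q : nat) :
  is_RInt (fun t => xi t ^ S q * u t ^ p * dxi t) 0 1
    (INR (fact p) / INR (S (S q)) ^ S p).
Proof.
assert (Q : 0 < INR (S (S q))) by (apply lt_0_INR; lia).
assert (xi0 : xi 0 = 0) by (unfold xi; field).
assert (xi1 : xi 1 = 1) by (unfold xi; field).
assert (u1 : u 1 = 0)
  by (unfold u; replace ((1 + 1 ^ 2) / (2 * 1)) with 1 by field; apply ln_1).
induction p as [|p IH].
- replace (_ / _) with (minus (/ INR (S (S q)) * xi 1 ^ S (S q))
    (/ INR (S (S q)) * xi 0 ^ S (S q))).
  + apply (is_RInt_derive (fun t => / INR (S (S q)) * xi t ^ S (S q))).
    * intros t _; pose proof (is_derive_scal _ t (/ INR (S (S q))) _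
        (is_derive_pow xi (S (S q)) t _ (is_derive_xi t))) as D.
      match type of D with is_derive _ _ ?l => replace (_ * dxi t) with l; [exact D|] end.
      cbn [Nat.pred]; rewrite pow_O; field; lra.
    * intros t Ht; rewrite Rmin_left, Rmax_right in Ht by lra.
      apply (continuous_Rmult (fun t => xi t ^ S q * u t ^ 0)).
      -- apply continuous_xi_u; lra.
      -- apply continuous_dxi.
  + rewrite xi0, xi1, pow1, pow_i, pow_1 by lia.
    unfold minus, plus, opp; simpl fact; simpl (INR 1); cbn -[INR]; field; lra.
- pose proof (is_RInt_derive (fun t => xi t ^ S (S q) * u t ^ S p)
    (fun t => INR (S (S q)) * (xi t ^ S q * u t ^ S p * dxi t)
     - INR (S p) * (xi t ^ S q * u t ^ p * dxi t)) 0 1) as D.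
  rewrite Rmin_left, Rmax_right in D by lra.
  assert (C : forall p t, 0 <= t ->
    continuous (fun t => xi t ^ S q * u t ^ p * dxi t) t).
  { intros p' t Ht; apply (continuous_Rmult (fun t => xi t ^ S q * u t ^ p')).
    - now apply continuous_xi_u.
    - apply continuous_dxi. }
  specialize (D (fun t Ht => is_derive_xi_u p q t (proj1 Ht))).
  match type of D with ?A -> _ => assert (D0 : A) end.
  { intros t [Ht _].
    apply (continuous_minus (fun t => _ * (xi t ^ S q * u t ^ S p * dxi t))).
    - apply (continuous_Rmult (fun _ => _)); [apply continuous_const|now apply C].
    - apply (continuous_Rmult (fun _ => _)); [apply continuous_const|now apply C]. }
  specialize (D D0).
  (* Solves the integrated product rule for the integral with exponent [S p]. *)
  pose proof (is_RInt_scal _ _ _ (/ INR (S (S q))) _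
    (is_RInt_plus _ _ _ _ _ _ D (is_RInt_scal _ _ _ (INR (S p)) _ IH))) as R.
  match type of R with is_RInt _ _ _ ?l => replace (_ / _) with l end.
  + eapply is_RInt_ext; [|exact R].
    intros t _; unfold scal, plus, mult; cbn -[INR pow]; unfold mult; cbn -[INR pow].
    field; lra.
  + unfold scal, plus, minus, plus, opp, mult; cbn -[INR pow fact]; unfold mult; cbn -[INR pow fact].
    rewrite u1, xi0, !(pow_i (S _)) by lia.
    rewrite fact_simpl, mult_INR, <- (tech_pow_Rmult _ (S p)).
    field; split; [apply pow_nonzero|]; lra.
Qed.

(** * Integrating the partial sums *)

Definition Spart_integrand (j p N : nat) (t : R) : R :=
  u t ^ p * Spart j N t / (1 + t ^ 2).

Lemma is_RInt_Spart (j p N : nat) :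
  is_RInt (Spart_integrand j p N) 0 1
    (sum_n (fun i => t_star (S i) j * coef i / 8
      * (INR (fact p) / INR (S (S (2 * i))) ^ S p)) N).
Proof.
(* Since [eta t / (1 + t ^ 2) = dxi t / 2], the constant [coef i / 4] of [basis] becomes
   [coef i / 8]. *)
set (F i t := t_star (S i) j * coef i / 8 * (xi t ^ S (2 * i) * u t ^ p * dxi t)).
assert (HF : forall i t, u t ^ p * (t_star (S i) j * basis i t) / (1 + t ^ 2) = F i t).
{ intros i t; unfold F, basis, eta, dxi.
  replace (2 * i + 1)%nat with (S (2 * i)) by lia.
  field; pose proof (one_plus_sq_pos t); lra. }
assert (IF : forall i, is_RInt (F i) 0 1 (t_star (S i) j * coef i / 8
      * (INR (fact p) / INR (S (S (2 * i))) ^ S p))).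
{ intros i; exact (is_RInt_scal _ _ _ _ _ (is_RInt_xi_u p (2 * i))). }
unfold Spart_integrand, Spart; induction N as [|N IH].
- rewrite sum_n_R_O; eapply is_RInt_ext; [|apply IF].
  intros t _; rewrite sum_n_R_O; symmetry; apply HF.
- rewrite sum_n_R_S; eapply is_RInt_ext; [|exact (is_RInt_plus _ _ _ _ _ _ IH (IF (S N)))].
  intros t _; rewrite sum_n_R_S, <- HF; unfold plus; simpl.
  unfold Rdiv; ring.
Qed.

(** The summands are nonnegative, so the partial sums increase to their limit, which [Spart_error]
    identifies. This control does not degenerate as [t] tends to 1, unlike the error bound. *)
Lemma Spart_bounds (j N : nat) (t : R) :
  0 <= t < 1 -> 0 <= Spart j N t <= Ti (2 * j + 1) t.
Proof.
intros Ht.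
assert (P : forall i, 0 <= t_star (S i) j * basis i t).
{ intros i; apply Rmult_le_pos; [apply t_star_bounds|apply basis_nonneg; lra]. }
split.
- unfold Spart; induction N as [|N IH].
  + rewrite sum_n_R_O; apply P.
  + rewrite sum_n_R_S; specialize (P (S N)); lra.
- set (r := (1 + t) / 2).
  destruct (Spart_error j r) as [e [He Hb]]; [unfold r; lra|].
  apply (is_lim_seq_incr_compare (fun N => Spart j N t)).
  + apply is_lim_seq_spec; intros eps.
    apply is_lim_seq_spec in He; destruct (He eps) as [N0 HN].
    exists N0; intros n Hn; specialize (HN n Hn).
    specialize (Hb n t ltac:(unfold r; lra)).
    rewrite Rminus_0_r in HN; apply Rabs_def2 in HN.
    rewrite Rabs_minus_sym; eapply Rle_lt_trans; [exact Hb|].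
    pose proof (cond_pos eps); nra.
  + intros n; unfold Spart; rewrite sum_n_R_S; specialize (P (S n)); lra.
Qed.

(** The inequality [t <= xi t] trades the linear factor for [xi t], which tames the power of the
    logarithm. *)
Lemma weighted_bound (p : nat) (t y c : R) : 0 <= t <= 1 -> Rabs y <= c * t -> 0 <= c ->
  Rabs (u t ^ p * y / (1 + t ^ 2)) <= c * Rabs (xi t * u t ^ p).
Proof.
intros Ht Hy Hc; pose proof (xi_bounds t Ht) as Hx; pose proof (one_plus_sq_pos t).
unfold Rdiv; rewrite !Rabs_mult, Rabs_inv.
rewrite (Rabs_pos_eq (1 + _)), (Rabs_pos_eq (xi t)) by lra.
assert (0 < / (1 + t ^ 2) <= 1).
{ split; [apply Rinv_0_lt_compat; lra|].
  rewrite <- Rinv_1; apply Rinv_le_contravar; nra. }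
pose proof (Rabs_pos (u t ^ p)); pose proof (Rabs_pos y).
assert (Rabs y <= c * xi t) by nra.
assert (Rabs (u t ^ p) * Rabs y <= Rabs (u t ^ p) * (c * xi t))
  by (apply Rmult_le_compat_l; lra).
assert (0 <= Rabs (u t ^ p) * Rabs y) by nra.
nra.
Qed.

Lemma integrand_u (j k : nat) (t : R) :
  integrand j k t = u t ^ (k - 1) * Ti (2 * j + 1) t / (1 + t ^ 2).
Proof. reflexivity. Qed.

Lemma ex_lim_Ti_1 (m : nat) : exists l : R, filterlim (Ti (S m)) (at_left 1) (locally l).
Proof.
apply (proj1 (filterlim_locally_cauchy (U := R_CompleteSpace) (F := at_left 1) (Ti (S m)))).
intros eps.
exists (fun t => (0 < t < 1 /\ 1 - t < eps / 2)); split.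
- assert (He : 0 < Rmin (eps / 2) 1)
    by (apply Rmin_glb_lt; pose proof (cond_pos eps); lra).
  exists (mkposreal _ He); intros t Hb Ht.
  apply Rabs_def2 in Hb; simpl in Hb; unfold minus, plus, opp in Hb; simpl in Hb.
  pose proof (Rmin_l (eps / 2) 1); pose proof (Rmin_r (eps / 2) 1); lra.
- intros s t [Hs Hs'] [Ht Ht'].
  unfold ball; simpl; unfold AbsRing_ball, abs, minus, plus, opp; simpl.
  eapply Rle_lt_trans; [exact (Ti_lipschitz m s t Hs Ht)|].
  apply Rabs_def1; lra.
Qed.

(** The integrand is continuous on [(0, 1)] with finite one-sided limits at both ends, so it agrees
    there with a function continuous everywhere; endpoint values do not affect the integral. *)
Lemma ex_RInt_integrand (j k : nat) : ex_RInt (integrand j k) 0 1.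
Proof.
set (p := (k - 1)%nat).
destruct (ex_lim_Ti_1 (2 * j)) as [l Hl].
assert (W : forall t, 0 < t -> continuous (fun t => u t ^ p / (1 + t ^ 2)) t).
{ intros t Ht; apply (ex_derive_continuous (V := R_NormedModule)).
  apply (ex_derive_mult (fun t => u t ^ p) (fun t => / (1 + t ^ 2))).
  - apply (ex_derive_pow u); eexists; now apply is_derive_u.
  - auto_derive; nra. }
assert (R : forall t, u t ^ p / (1 + t ^ 2) * Ti (S (2 * j)) t = integrand j k t).
{ intros t; rewrite integrand_u, Nat.add_1_r; unfold Rdiv, p; ring. }
destruct (C0_extension_lt (integrand j k) 0 (u 1 ^ p / (1 + 1 ^ 2) * l) 0 1)
  as [g [Hg [Eg _]]].
- lra.
- intros c Hc.
  apply (continuous_ext (fun t => u t ^ p / (1 + t ^ 2) * Ti (S (2 * j)) t)); [exact R|].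
  apply continuous_Rmult; [apply W; lra|].
  destruct (is_euler_Ti (2 * j) c) as [d [Hd _]]; [lra|].
  apply (ex_derive_continuous (V := R_NormedModule)); now exists d.
- apply filterlim_locally; intros eps.
  (* Near 0 the integrand is dominated by [Rabs (xi t * u t ^ p)], because [Ti] is at most [t]
     there, and this tends to 0. *)
  pose proof (continuous_xi_u p 0 0 (Rle_refl 0)) as C.
  destruct (proj1 (filterlim_locally _ _) C eps) as [d Hd].
  assert (He : 0 < Rmin d (1 / 2))
    by (apply Rmin_glb_lt; pose proof (cond_pos d); lra).
  exists (mkposreal _ He); intros t Hb Ht.
  pose proof (Rmin_l d (1 / 2)); pose proof (Rmin_r d (1 / 2)).
  assert (Hb' : Rabs t < Rmin d (1 / 2)).
  { revert Hb; unfold ball; simpl; unfold AbsRing_ball, abs, minus, plus, opp; simpl.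
    now rewrite Ropp_0, Rplus_0_r. }
  assert (Ht1 : 0 <= t < 1) by (apply Rabs_def2 in Hb'; lra).
  specialize (Hd t); unfold ball in *; simpl in *.
  unfold AbsRing_ball, abs, minus, plus, opp in *; simpl in *.
  replace (xi 0) with 0 in Hd by (unfold xi; field).
  rewrite ?Rmult_1_r, ?Rmult_0_l, ?Ropp_0, ?Rplus_0_r in *.
  eapply Rle_lt_trans; [|apply Hd; lra].
  rewrite <- (Rmult_1_l (Rabs (xi t * _))).
  apply weighted_bound; [lra| |lra].
  rewrite Rmult_1_l; now apply Ti_le.
- apply filterlim_ext with (fun t => u t ^ p / (1 + t ^ 2) * Ti (S (2 * j)) t); [exact R|].
  apply (filterlim_comp_2 (G := locally (u 1 ^ p / (1 + 1 ^ 2))) (H := locally l)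
    (fun t => u t ^ p / (1 + t ^ 2)) (Ti (S (2 * j))) Rmult); [|exact Hl|].
  + eapply filterlim_filter_le_1; [apply filter_le_within|apply W; lra].
  + apply (filterlim_mult (u 1 ^ p / (1 + 1 ^ 2)) l).
- apply (ex_RInt_ext g).
  + intros t; rewrite Rmin_left, Rmax_right by lra; apply Eg.
  + apply (ex_RInt_continuous (V := R_CompleteNormedModule)); intros z _; apply Hg.
Qed.

(** The interval is cut at [r] near 1: on [[0, r]] the error is uniformly small for large [N], and
    on [[r, 1]] it is bounded independently of [N] over a short interval. *)
Lemma is_lim_seq_RInt_Spart (j k : nat) :
  is_lim_seq (fun N => RInt (Spart_integrand j (k - 1) N) 0 1) (RInt (integrand j k) 0 1).
Proof.
set (p := (k - 1)%nat); set (f := integrand j k).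
assert (If : ex_RInt f 0 1) by apply ex_RInt_integrand.
set (M := 2 ^ p * INR (fact p)).
assert (HM : 0 < M) by (apply Rmult_lt_0_compat; [apply pow_lt; lra|apply INR_fact_lt_0]).
(* [M] bounds the error for [t < 1]. At [t = 1], where [Ti_le] does not apply, the partial sum
   vanishes with [eta] and the error is [f 1] itself. *)
set (K := M + Rabs (f 1)).
assert (HK : 0 < K) by (unfold K; pose proof (Rabs_pos (f 1)); lra).
apply is_lim_seq_spec; intros eps; pose proof (cond_pos eps) as Heps.
set (r := 1 - Rmin (1 / 2) (eps / (2 * K))).
assert (Hr : 0 < r < 1 /\ (1 - r) * K <= eps / 2).
{ assert (0 < eps / (2 * K)) by (apply Rdiv_lt_0_compat; lra).
  pose proof (Rmin_l (1 / 2) (eps / (2 * K))); pose proof (Rmin_r (1 / 2) (eps / (2 * K))).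
  pose proof (Rmin_glb_lt (1 / 2) (eps / (2 * K)) 0 ltac:(lra) ltac:(lra)).
  unfold r; repeat split; try lra.
  replace (eps / 2) with (eps / (2 * K) * K) by (field; lra).
  apply Rmult_le_compat_r; lra. }
destruct Hr as [Hr HrK].
destruct (Spart_error j r Hr) as [e [He Hb]].
apply is_lim_seq_spec in He.
assert (Hd : 0 < eps / (2 * M)) by (apply Rdiv_lt_0_compat; lra).
destruct (He (mkposreal _ Hd)) as [N0 HN]; exists N0; intros N HNN.
specialize (HN N HNN); simpl in HN; rewrite Rminus_0_r in HN.
apply Rabs_def2 in HN.
set (g := Spart_integrand j p N).
assert (Ig : ex_RInt g 0 1) by (eexists; apply is_RInt_Spart).
set (h t := minus (f t) (g t)).
assert (Ih : ex_RInt h 0 1) by (now apply (ex_RInt_minus f g)).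
assert (Eh : RInt h 0 1 = RInt f 0 1 - RInt g 0 1) by (now apply (RInt_minus f g)).
assert (Hh : forall t, h t =
  u t ^ p * (Ti (2 * j + 1) t - Spart j N t) / (1 + t ^ 2)).
{ intros t; match goal with |- _ = ?y => change (f t - g t = y :> R) end.
  unfold f, g; rewrite integrand_u.
  unfold Spart_integrand; fold p; unfold Rdiv; ring. }
rewrite Rabs_minus_sym, <- Eh.
assert (I1 : ex_RInt h 0 r) by (apply (ex_RInt_Chasles_1 h 0 r 1); [lra|exact Ih]).
assert (I2 : ex_RInt h r 1) by (apply (ex_RInt_Chasles_2 h 0 r 1); [lra|exact Ih]).
rewrite <- (RInt_Chasles h 0 r 1 I1 I2).
assert (B1 : Rabs (RInt h 0 r) <= (r - 0) * (Rabs (e N) * M)).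
{ apply abs_RInt_le_const; [lra|exact I1|]; intros t Ht.
  rewrite Hh; eapply Rle_trans.
  - apply (weighted_bound p t _ (Rabs (e N))); [lra| |apply Rabs_pos].
    eapply Rle_trans; [now apply Hb|].
    apply Rmult_le_compat_r; [lra|apply Rle_abs].
  - apply Rmult_le_compat_l; [apply Rabs_pos|apply xi_u_pow_bound]. }
assert (B2 : Rabs (RInt h r 1) <= (1 - r) * K).
{ apply abs_RInt_le_const; [lra|exact I2|]; intros t Ht.
  destruct (Req_dec t 1) as [->|t1].
  - unfold h, minus, plus, opp; simpl.
    replace (g 1) with 0; [unfold K; rewrite Ropp_0, Rplus_0_r; lra|].
    unfold g, Spart_integrand, Spart.
    replace (sum_n _ N) with 0; [unfold Rdiv; ring|].
    clear; induction N as [|N IH].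
    + rewrite sum_n_R_O; unfold basis, eta; field.
    + rewrite sum_n_R_S, <- IH; unfold basis, eta; field.
  (* From [0 <= Spart <= Ti <= t] the difference is at most [t], whatever [N] is. *)
  - rewrite Hh; eapply Rle_trans.
    + apply (weighted_bound p t _ 1); [lra| |lra].
      pose proof (Spart_bounds j N t ltac:(lra)) as SB.
      pose proof (Ti_le (2 * j + 1) t ltac:(lra)) as TB.
      rewrite Rabs_pos_eq in TB |- * by lra; lra.
    + rewrite Rmult_1_l; eapply Rle_trans; [apply xi_u_pow_bound|].
      fold M; unfold K; pose proof (Rabs_pos (f 1)); lra. }
eapply Rle_lt_trans; [apply Rabs_triang|].
assert (Rabs (e N) * M < eps / 2).
{ replace (eps / 2) with (eps / (2 * M) * M) by (field; lra).
  apply Rmult_lt_compat_r; [lra|apply Rabs_def1; lra]. }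
assert (0 <= Rabs (e N) * M) by (apply Rmult_le_pos; [apply Rabs_pos|lra]).
nra.
Qed.

Theorem theorem3p4 (j k : nat) (hk : (0 < k)%nat) :
  ex_series (fun i => summand j k (S i)) /\
  ex_RInt (integrand j k) 0 1 /\
  Series (fun i => summand j k (S i)) =
    2 ^ (k + 3) / INR (fact (k - 1)) * RInt (integrand j k) 0 1.
Proof.
set (c := 2 ^ (k + 3) / INR (fact (k - 1))).
assert (HS : is_series (fun i => summand j k (S i)) (c * RInt (integrand j k) 0 1)).
{ change (is_lim_seq (sum_n (fun i => summand j k (S i))) (c * RInt (integrand j k) 0 1)).
  apply (is_lim_seq_ext
    (fun N => c * RInt (Spart_integrand j (k - 1) N) 0 1)).
  - intros N; rewrite (is_RInt_unique _ _ _ _ (is_RInt_Spart j (k - 1) N)).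
    etransitivity; [symmetry; exact (sum_n_mult_l (K := R_Ring) c _ N)|].
    apply sum_n_ext; intros i; match goal with |- mult ?x ?y = ?z => change (x * y = z :> R) end.
    (* With [n = S i], the factor [(k - 1)! / (2 * n) ^ k] and the [1 / 8] cancel [c] up to
       [1 / n ^ k], which together with the [1 / n] in [coef i] gives [1 / n ^ (k + 1)]. *)
    unfold c, summand, coef.
    destruct k as [|k]; [lia|].
    replace (S k - 1)%nat with k by lia.
    replace (INR (S (S (2 * i)))) with (2 * INR (S i))
      by (rewrite !S_INR, mult_INR; simpl; ring).
    rewrite Rpow_mult_distr.
    replace (S k + 3)%nat with (3 + S k)%nat by lia.
    rewrite (pow_add 2 3), (Nat.add_1_r (S k)), <- (tech_pow_Rmult _ (S k)).
    assert (0 < INR (S i)) by (apply lt_0_INR; lia).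
    assert (INR (S i) ^ S k <> 0) by (apply pow_nonzero; lra).
    assert (2 ^ S k <> 0) by (apply pow_nonzero; lra).
    pose proof (INR_fact_neq_0 k).
    assert (Binomial.C (2 * S i) (S i) <> 0).
    { unfold Binomial.C; apply Rmult_integral_contrapositive; split; [apply INR_fact_neq_0|].
      apply Rinv_neq_0_compat, Rmult_integral_contrapositive; split; apply INR_fact_neq_0. }
    field; repeat split; auto; lra.
  - apply (is_lim_seq_scal_l _ c (RInt (integrand j k) 0 1)).
    apply is_lim_seq_RInt_Spart. }
repeat split.
- eexists; exact HS.
- apply ex_RInt_integrand.
- now apply is_series_unique.
Qed.
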